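(* Let $G$ be a generic countable torsion-free group. Then: (1) $G$ does not admit a Rubin group or a weakly Rubin group as a quotient. (2) The Rubin poset $\mathcal{P}(G)$ coincides with the poset of cyclic subgroups of $G$, ordered by inclusion, and contains both bi-infinite chains and infinite antichains. (3) Two non-trivial elements of $G$ commute if and only if they are algebraically disjoint in $G$.
   Context: Space of groups and genericity: a countably infinite group is identified with a group structure on $\mathbb{N}$, i.e. a point of $X=\mathbb{N}^{\mathbb{N}\times\mathbb{N}}\times\mathbb{N}^{\mathbb{N}}\times\mathbb{N}$ (multiplication, inversion, identity) with the product topology. The torsion-free groups form a closed, hence Polish, subspace $\mathcal{G}_{\mathrm{tf}}$. A property is said to hold for a generic countable torsion-free group if the set of groups in $\mathcal{G}_{\mathrm{tf}}$ satisfying it is comeager in $\mathcal{G}_{\mathrm{tf}}$ (contains a countable intersection of dense open sets). Actions: for $G\le \mathrm{Homeo}(X)$ and $U\subseteq X$ open, the rigid stabilizer $G_U$ is the subgroup of elements acting as the identity outside $U$. The action is locally dense if for every open $U$ and $p\in U$, the closure of $G_U\cdot p$ has nonempty interior; it is locally moving if $G_U\ne 1$ for every nonempty open $U$. A Rubin action is a faithful locally dense action on a locally compact Hausdorff space with no isolated points; a group is a Rubin group if it admits a Rubin action. A group is a weakly Rubin group if it admits a homomorphism to $\mathrm{Homeo}(X)$ for some Hausdorff space $X$ with at least two points whose image is a locally moving group of homeomorphisms. Algebraic disjointness: in a group $G$, an element $g$ is algebraically disjoint from $f$ if for every $h\in G$ with $[f,h]\ne1$ there exist $a,b\in C_G(g)$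 with $1\ne[a,[b,h]]\in C_G(g)$ (here $C_G(\cdot)$ denotes centralizer). Rubin poset: for $f\in G$ let $S_f=\{g^{12}\mid g\in G \text{ algebraically disjoint from } f\}$ and $C_G(S_f)$ its centralizer. $\mathcal{P}(G)$ is the set $\{C_G(S_{f_1})\cap\cdots\cap C_G(S_{f_n})\mid f_1,\dots,f_n\in G,\ n\ge1\}$ partially ordered by inclusion. *)

(* Defs.v *)
From HB Require Import structures.
From mathcomp Require Import all_boot all_order all_algebra.
From mathcomp Require Import all_classical all_reals all_analysis.
Set Implicit Arguments. Unset Strict Implicit. Unset Printing Implicit Defensive.
Import Order.TTheory GRing.Theory Num.Theory.
Local Open Scope classical_set_scope.

Record grp_ops (T : Type) := GrpOps {
  gmul : T -> T -> T;
  ginv : T -> T;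
  gone : T }.

Section GroupDefs.
Variables (T : Type) (o : grp_ops T).
Local Notation "x * y" := (gmul o x y).
Local Notation "x ^-1" := (ginv o x).
Local Notation "1" := (gone o).

Definition is_group : Prop :=
  [/\ forall x y z, x * (y * z) = (x * y) * z,
      forall x, 1 * x = x, forall x, x * 1 = x,
      forall x, x^-1 * x = 1 & forall x, x * x^-1 = 1].

Definition gexpn (x : T) (n : nat) : T := iter n (gmul o x) 1.
Definition gexpz (x : T) (z : int) : T :=
  match z with Posz n => gexpn x n | Negz n => (gexpn x n.+1)^-1 end.

Definition torsion_free : Prop :=
  forall x n, (0 < n)%N -> gexpn x n = 1 -> x = 1.

Definition gcommute (x y : T) : Prop := x * y = y * x.
Definition gcomm (x y : T) : T := x * y * x^-1 * y^-1.

Definition alg_disjoint (g f : T) : Prop :=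
  forall h, gcomm f h <> 1 ->
    exists a b, gcommute a g /\ gcommute b g /\
      gcomm a (gcomm b h) <> 1 /\ gcommute (gcomm a (gcomm b h)) g.

Definition S_set (f : T) : set T :=
  [set y | exists g, alg_disjoint g f /\ y = gexpn g 12].

Definition centralizer (S : set T) : set T :=
  [set x | forall s, S s -> gcommute x s].

Definition rubin_poset (H : set T) : Prop :=
  exists (n : nat) (fs : 'I_n.+1 -> T),
    H = [set x | forall i, centralizer (S_set (fs i)) x].

Definition cyclic_subgroup (H : set T) : Prop :=
  exists x, H = [set y | exists z : int, y = gexpz x z].

Definition group_hom (Q : Type) (oQ : grp_ops Q) (phi : T -> Q) : Prop :=
  forall x y, phi (x * y) = gmul oQ (phi x) (phi y).

End GroupDefs.

Definition is_quotient (T : Type) (o : grp_ops T) (Q : Type) (oQ : grp_ops Q)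
  : Prop :=
  is_group oQ /\
  exists phi : T -> Q, group_hom o oQ phi /\ forall q, exists x, phi x = q.

Definition homeomorphism (X : topologicalType) (h : X -> X) : Prop :=
  exists h' : X -> X, [/\ cancel h h', cancel h' h, continuous h & continuous h'].

Definition homeo_action (T : Type) (o : grp_ops T) (X : topologicalType)
  (rho : T -> X -> X) : Prop :=
  (forall g, homeomorphism (rho g)) /\
  (forall g h, rho (gmul o g h) = rho g \o rho h).

Definition rigid_stab (T : Type) (X : topologicalType) (rho : T -> X -> X)
  (U : set X) : set T :=
  [set g | forall x, ~ U x -> rho g x = x].

Definition faithful_action (T : Type) (o : grp_ops T) (X : topologicalType)
  (rho : T -> X -> X) : Prop :=
  forall g, rho g = id -> g = gone o.

Definition locally_dense (T : Type) (X : topologicalType) (rho : T -> X -> X)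
  : Prop :=
  forall (U : set X) (p : X), open U -> U p ->
    interior (closure [set rho g p | g in rigid_stab rho U]) !=set0.

Definition locally_moving (T : Type) (X : topologicalType) (rho : T -> X -> X)
  : Prop :=
  forall U : set X, open U -> U !=set0 ->
    exists g, rigid_stab rho U g /\ rho g <> id.

Definition no_isolated_points (X : topologicalType) : Prop :=
  forall x : X, ~ open [set x].

Definition rubin_action (T : Type) (o : grp_ops T) (X : topologicalType)
  (rho : T -> X -> X) : Prop :=
  [/\ homeo_action o rho, faithful_action o rho & locally_dense rho] /\
  [/\ locally_compact [set: X], hausdorff_space X & no_isolated_points X].

Definition rubin_group (T : Type) (o : grp_ops T) : Prop :=
  exists (X : topologicalType) (rho : T -> X -> X),
    (exists x : X, True) /\ rubin_action o rho.

Definition weakly_rubin_group (T : Type) (o : grp_ops T) : Prop :=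
  exists (X : topologicalType) (rho : T -> X -> X),
    [/\ hausdorff_space X, (exists x y : X, x <> y), homeo_action o rho
      & locally_moving rho].

(* points of X = N^(NxN) x N^N x N are the triples (mul, inv, id) *)
Definition Gtf : set (grp_ops nat) :=
  [set o | is_group o /\ torsion_free o].

(* basic open neighbourhoods of the product topology (N discrete):
   agreement on all coordinates with indices <= n *)
Definition agree (n : nat) (o o' : grp_ops nat) : Prop :=
  [/\ forall i j, (i <= n)%N -> (j <= n)%N -> gmul o i j = gmul o' i j,
      forall i, (i <= n)%N -> ginv o i = ginv o' i
    & gone o = gone o'].

Definition open_in_Gtf (A : set (grp_ops nat)) : Prop :=
  A `<=` Gtf /\
  forall o, A o -> exists n, forall o', Gtf o' -> agree n o o' -> A o'.

Definition dense_in_Gtf (A : set (grp_ops nat)) : Prop :=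
  forall o n, Gtf o -> exists o', [/\ Gtf o', agree n o o' & A o'].

Definition comeager_in_Gtf (P : set (grp_ops nat)) : Prop :=
  exists D : nat -> set (grp_ops nat),
    (forall k, open_in_Gtf (D k) /\ dense_in_Gtf (D k)) /\
    (forall o, (forall k, D k o) -> P o).

(* Main.v *)
Require Import Defs.
From HB Require Import structures.
From mathcomp Require Import all_boot all_order all_algebra.
From mathcomp Require Import all_classical all_reals all_analysis.
From mathcomp Require Import zify ring.
Import Order.TTheory GRing.Theory Num.Theory.
Set Implicit Arguments. Unset Strict Implicit. Unset Printing Implicit Defensive.
Local Open Scope classical_set_scope.

(** Two families of open dense conditions suffice: any two nontrivial elements
are conjugate; and for h outside <g> there are a, b in C(g) such that
[a, [b, h]] is nontrivial and lies in C(g), and a^12 does not commute with h.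
The second gives (3), then C(S_f) = <f> and (2). For (1), conjugacy makes G
simple, so a weakly Rubin quotient would be a faithful locally moving action of
G; choosing f with five disjoint translates of an open set U and h supported in
U contradicts the existence of a and b for g = f.

Density is a matter of embedding a torsion-free G into larger torsion-free
groups. For the second family the unrestricted wreath product of a
Heisenberg group by G works. For the first, x and y are conjugate by some tau
in the symmetric group P of G * G, which has torsion; instead of P take the
pairs (c, z) with z in P and c a 1-chain with boundary z v0 - v0 on the vertex
set P / G, where v0 is the trivial coset. Such a pair with z of finite order
n > 1 has infinite order: <z> acts freely on P / G, so c projects to a cycle in
the quotient graph whose class in Z/n is 1. *)

(** * Groups given by their operations *)

Section GroupTheory.
Variables (T : Type) (o : grp_ops T) (Go : is_group o).
Local Notation "x * y" := (gmul o x y).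
Local Notation "x ^-1" := (ginv o x).
Local Notation "1" := (gone o).
Local Notation gexpn := (gexpn o).
Local Notation gexpz := (gexpz o).

Lemma gmulA x y z : x * (y * z) = x * y * z. Proof. by case: Go. Qed.
Lemma gmul1 x : x * 1 = x. Proof. by case: Go. Qed.
Lemma gmul1l x : 1 * x = x. Proof. by case: Go. Qed.
Lemma gmulVl x : x^-1 * x = 1. Proof. by case: Go. Qed.
Lemma gmulV x : x * x^-1 = 1. Proof. by case: Go. Qed.
Lemma gmulK x y : x * y * y^-1 = x. Proof. by rewrite -gmulA gmulV gmul1. Qed.
Lemma gmulKV x y : x * y^-1 * y = x. Proof. by rewrite -gmulA gmulVl gmul1. Qed.
Lemma gmulKl x y : x^-1 * (x * y) = y. Proof. by rewrite gmulA gmulVl gmul1l. Qed.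
Lemma gmulVKl x y : x * (x^-1 * y) = y. Proof. by rewrite gmulA gmulV gmul1l. Qed.
Lemma gmulIl x y z : x * y = x * z -> y = z.
Proof. by move=> e; rewrite -(gmulKl x y) e gmulKl. Qed.
Lemma gmulIr x y z : y * x = z * x -> y = z.
Proof. by move=> e; rewrite -(gmulK y x) e gmulK. Qed.
Lemma ginv_eq x y : x * y = 1 -> x^-1 = y.
Proof. by move=> e; apply: (@gmulIl x); rewrite e gmulV. Qed.
Lemma ginvK x : x^-1^-1 = x. Proof. by apply: ginv_eq; rewrite gmulVl. Qed.
Lemma ginv1 : 1^-1 = 1. Proof. by apply: ginv_eq; rewrite gmul1. Qed.
Lemma ginvM x y : (x * y)^-1 = y^-1 * x^-1.
Proof. by apply: ginv_eq; rewrite gmulA gmulK gmulV. Qed.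

Lemma gexpnD x m n : gexpn x (m + n) = gexpn x m * gexpn x n.
Proof.
elim: m => [|m IH]; first by rewrite gmul1l.
by rewrite addSn /gexpn !iterS -/(gexpn x _) -/(gexpn x _) IH gmulA.
Qed.
Lemma gexpn1 x : gexpn x 1%N = x. Proof. exact: gmul1. Qed.
Lemma gexpnS x n : gexpn x n.+1 = x * gexpn x n. Proof. by []. Qed.
Lemma gexpnSr x n : gexpn x n.+1 = gexpn x n * x.
Proof. by rewrite -addn1 gexpnD gexpn1. Qed.
Lemma gexpn_one n : gexpn 1 n = 1.
Proof. by elim: n => // n IH; rewrite gexpnS IH gmul1. Qed.
Lemma gexpnM x m n : gexpn x (m * n)%N = gexpn (gexpn x m) n.
Proof. by elim: n => [|n IH]; rewrite ?muln0 // mulnS gexpnD IH. Qed.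

Lemma gexpzS x z : gexpz x (z + 1)%R = x * gexpz x z.
Proof.
case: z => [n|[|n]].
- have -> : (Posz n + 1)%R = Posz n.+1 by lia.
  by [].
- have -> : (Negz 0 + 1)%R = 0%R by [].
  by rewrite /Defs.gexpz gexpn1 gmulV.
have -> : (Negz n.+1 + 1)%R = Negz n by lia.
by rewrite /Defs.gexpz (gexpnSr x n.+1) ginvM gmulVKl.
Qed.
Lemma gexpzP x z : gexpz x (z - 1)%R = x^-1 * gexpz x z.
Proof. by rewrite -{2}(subrK 1%R z) gexpzS gmulKl. Qed.
Lemma gexpzD x y z : gexpz x (y + z)%R = gexpz x y * gexpz x z.
Proof.
elim/int_rec: y => [|n IH|n IH].
- by rewrite add0r /= gmul1l.
- have -> : (n.+1%:Z + z = n%:Z + z + 1)%R by lia.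
  by rewrite gexpzS IH gmulA -gexpzS; congr (gexpz _ _ * _); lia.
have -> : (- n.+1%:Z + z = - n%:Z + z - 1)%R by lia.
by rewrite gexpzP IH gmulA -gexpzP; congr (gexpz _ _ * _); lia.
Qed.
Lemma gexpz1 x : gexpz x 1%R = x. Proof. exact: gmul1. Qed.
Lemma gexpzN x z : gexpz x (- z)%R = (gexpz x z)^-1.
Proof. by apply/esym/ginv_eq; rewrite -gexpzD subrr. Qed.
Lemma gexpzM x (y z : int) : gexpz x (y * z)%R = gexpz (gexpz x y) z.
Proof.
elim/int_rec: z => [|n IH|n IH]; first by rewrite mulr0.
- have -> : (n.+1%:Z = n%:Z + 1)%R by lia.
  by rewrite mulrDr mulr1 (addrC _ y) gexpzS -IH -gexpzD.
have -> : (- n.+1%:Z = - n%:Z - 1)%R by lia.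
by rewrite mulrBr mulr1 (addrC _ (- y)%R) gexpzP -IH -gexpzN -gexpzD.
Qed.

Lemma gcommute_sym x y : gcommute o x y -> gcommute o y x.
Proof. by []. Qed.
Lemma gcommuteM x y z : gcommute o x z -> gcommute o y z -> gcommute o (x * y) z.
Proof. by rewrite /gcommute => xz yz; rewrite -gmulA yz gmulA xz gmulA. Qed.
Lemma gcommuteV x z : gcommute o x z -> gcommute o x^-1 z.
Proof.
by rewrite /gcommute => xz; apply: (@gmulIl x); rewrite gmulVKl gmulA xz gmulK.
Qed.
Lemma gcommute1 z : gcommute o 1 z.
Proof. by rewrite /gcommute gmul1 gmul1l. Qed.
Lemma gcommuteXn x z n : gcommute o x z -> gcommute o (gexpn x n) z.
Proof.
move=> xz; elim: n => [|n IH]; first exact: gcommute1.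
by rewrite gexpnS; apply: gcommuteM.
Qed.
Lemma gcommuteXz x z n : gcommute o x z -> gcommute o (gexpz x n) z.
Proof.
by case: n => n xz; [apply: gcommuteXn|apply/gcommuteV/gcommuteXn].
Qed.
Lemma gcomm1P x y : gcomm o x y = 1 <-> gcommute o x y.
Proof.
rewrite /gcomm /gcommute; split=> [e|->]; last by rewrite gmulK gmulV.
by apply: (@gmulIr x^-1); apply: (@gmulIr y^-1); rewrite e gmulK gmulV.
Qed.

(** A product of conjugates of [h] and its inverse by [a b], [a], [1] and [b]: this locates the
    support of the commutator when [h] is supported in a small set. *)
Lemma gcomm_gcomm a b h : gcomm o a (gcomm o b h) =
  (a * b * h * (a * b)^-1) * (a * h^-1 * a^-1) * h * (b * h^-1 * b^-1).
Proof. by rewrite /gcomm !ginvM !ginvK !gmulA !gmulKV. Qed.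

Section TorsionFree.
Hypothesis tf : torsion_free o.
Lemma gexpz_eq1 x z : gexpz x z = 1 -> z <> 0%R -> x = 1.
Proof.
case: z => [[|n]|n] //= e _; first exact: (tf (n := n.+1)).
by apply: (tf (n := n.+1)) => //; rewrite -(ginvK (gexpn _ _)) e ginv1.
Qed.
Lemma gexpz_inj x : x <> 1 -> injective (gexpz x).
Proof.
move=> x1 y z e; apply/eqP; rewrite -subr_eq0; apply/eqP; apply: contrapT => d.
by apply: x1; apply: (gexpz_eq1 _ d); rewrite gexpzD gexpzN e gmulV.
Qed.
End TorsionFree.

End GroupTheory.

Section Hom.
Variables (T : Type) (o : grp_ops T) (Go : is_group o).
Variables (Q : Type) (q : grp_ops Q) (Gq : is_group q).
Variables (phi : T -> Q) (phiM : group_hom o q phi).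
Lemma hom1 : phi (gone o) = gone q.
Proof.
apply: (gmulIl Gq (x := phi (gone o))).
by rewrite -phiM (gmul1 Go) (gmul1 Gq).
Qed.
Lemma homV x : phi (ginv o x) = ginv q (phi x).
Proof.
by apply/esym/(ginv_eq Gq); rewrite -phiM (gmulV Go) hom1.
Qed.
Lemma homXn x n : phi (gexpn o x n) = gexpn q (phi x) n.
Proof. by elim: n => [|n IH]; rewrite ?hom1 // !gexpnS phiM IH. Qed.
Lemma homR x y : phi (gcomm o x y) = gcomm q (phi x) (phi y).
Proof. by rewrite /gcomm !phiM !homV. Qed.
Lemma hom_commute x y : gcommute o x y -> gcommute q (phi x) (phi y).
Proof. by rewrite /gcommute -!phiM => ->. Qed.
Lemma inj_hom_commute x y :
  injective phi -> gcommute q (phi x) (phi y) -> gcommute o x y.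
Proof. by move=> inj; rewrite /gcommute -!phiM => /inj. Qed.
End Hom.

(** * Orbits and chains *)

Definition subgroup (T : Type) (o : grp_ops T) (S : set T) : Prop :=
  [/\ S (gone o), forall x y, S x -> S y -> S (gmul o x y)
    & forall x, S x -> S (ginv o x)].

Definition torsion_free_on (T : Type) (o : grp_ops T) (S : set T) : Prop :=
  forall x n, S x -> (0 < n)%N -> gexpn o x n = gone o -> x = gone o.

Lemma orbit_representative (V : Type) (r : V -> V -> Prop) :
    (forall v, r v v) -> (forall v w, r v w -> r w v) ->
    (forall u v w, r u v -> r v w -> r u w) ->
  exists R : V -> V, (forall v, r v (R v)) /\ (forall v w, r v w -> R v = R w).
Proof.
move=> r1 rV rM.
(* The representative is chosen from the class as a set, so equivalent points get the same one;
   [option] makes the choice total on all sets, the empty one included. *)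
have /choice[F HF] : forall A : set V, exists u : option V,
    forall v, A v -> exists2 w, u = Some w & A w.
  move=> A.
  have [[v Av]|nA] := pselect (exists v, A v).
    by exists (Some v) => w _; exists v.
  by exists None => w Aw; case: nA; exists w.
exists (fun v => odflt v (F [set w | r v w])); split=> [v|v w vw].
  by have [w -> /=] := HF [set w | r v w] v (r1 v).
have -> : [set u | r v u] = [set u | r w u].
  by apply/seteqP; split=> u /=; [apply: rM; apply: rV|apply: rM].
by have [u ->] := HF [set u | r w u] w (r1 w).
Qed.

Section StableLetter.
Variables (P : Type) (p : grp_ops P) (Gp : is_group p).
Variables (V : Type) (act : P -> V -> V) (v0 : V).
Hypothesis act1 : forall v, act (gone p) v = v.
Hypothesis actM : forall z w v, act (gmul p z w) v = act z (act w v).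
Hypothesis stab_torsion_free : forall z v n, (0 < n)%N ->
  gexpn p z n = gone p -> act z v = v -> z = gone p.

(** Pullback of edge functions reverses products, so the induced action on functionals is a left
    action and [chain_ops] is a semidirect product. *)
Let shift (z : P) (m : V * V -> int) : V * V -> int :=
  fun e => m (act z e.1, act z e.2).
(** The coboundary: a chain evaluated at [delta l] is its boundary evaluated at [l]. *)
Let delta (l : V -> int) : V * V -> int := fun e => (l e.2 - l e.1)%R.

Let actK z v : act (ginv p z) (act z v) = v.
Proof. by rewrite -actM (gmulVl Gp) act1. Qed.
Let shift1 m : shift (gone p) m = m.
Proof. by apply/funext => -[a b]; rewrite /shift !act1. Qed.
Let shiftM z w m : shift (gmul p z w) m = shift w (shift z m).
Proof. by apply/funext => -[a b]; rewrite /shift !actM. Qed.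

(* A 1-chain on the complete graph with vertex set V is represented by the
   functional it induces on the functions on edges. *)
Definition chain_ops : grp_ops (((V * V -> int) -> int) * P)%type :=
  GrpOps
    (fun x y => (fun m => (x.1 m + y.1 (shift x.2 m))%R, gmul p x.2 y.2))
    (fun x => (fun m => (- x.1 (shift (ginv p x.2) m))%R, ginv p x.2))
    (fun=> 0%R, gone p).

Lemma chain_ops_group : is_group chain_ops.
Proof.
split.
- move=> [a x] [b y] [c z]; congr (_, _) => /=; last exact: gmulA.
  by apply/funext => m; rewrite shiftM addrA.
- move=> [a x]; congr (_, _) => /=; last exact: gmul1l.
  by apply/funext => m; rewrite shift1 add0r.
- move=> [a x]; congr (_, _) => /=; last exact: gmul1.
  by apply/funext => m; rewrite addr0.
- move=> [a x]; congr (_, _) => /=; last exact: gmulVl.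
  by apply/funext => m; rewrite addNr.
- move=> [a x]; congr (_, _) => /=; last exact: gmulV.
  by apply/funext => m; rewrite -shiftM (gmulV Gp) shift1 subrr.
Qed.

(* The pairs (c, z) with boundary c = z v0 - v0. *)
Definition path_chains : set (((V * V -> int) -> int) * P)%type :=
  [set x | (forall m m', x.1 (fun e => m e + m' e)%R = (x.1 m + x.1 m')%R) /\
           (forall l, x.1 (delta l) = (l (act x.2 v0) - l v0)%R)].

Lemma path_chains_subgroup : subgroup chain_ops path_chains.
Proof.
split.
- by split=> [m m'|l] /=; rewrite ?addr0 // act1 subrr.
- move=> [a x] [b y] [/= aD ad] [/= bD bd]; split=> [m m'|l] /=.
    by rewrite aD -addrACA -bD.
  by rewrite ad [shift _ _](_ : _ = delta (l \o act x)) // bd /= actM; ring.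
move=> [a x] [/= aD ad]; split=> [m m'|l] /=.
  by rewrite -opprD -aD.
rewrite [shift _ _](_ : _ = delta (l \o act (ginv p x))) // ad /=.
by rewrite actK opprB.
Qed.

Lemma chain_expn x n : (gexpn chain_ops x n).2 = gexpn p x.2 n.
Proof. by elim: n => // n IH; rewrite !gexpnS /= IH. Qed.

(** The chain of the power is the sum of the translates of [x.1] by the first [n] powers of [x.2],
    and these all agree on an invariant [m]. *)
Lemma chain_expn_shift x n m : shift x.2 m = m ->
  (gexpn chain_ops x n).1 m = (x.1 m *+ n)%R.
Proof. by move=> e; elim: n => // n IH; rewrite gexpnS /= e IH mulrS. Qed.

(** By [stab_torsion_free] the powers of [z] act freely, and minimality makes [n] the exact order of
    [z]. *)
Lemma act_expn_inj z n i j v : gexpn p z n = gone p -> (0 < n)%N ->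
  (forall k, (0 < k < n)%N -> gexpn p z k <> gone p) ->
  act (gexpn p z i) v = act (gexpn p z j) v -> (i = j %[mod n])%N.
Proof.
move=> zn n0 nmin.
wlog ij : i j / (i <= j)%N.
  by move=> H; case/orP: (leq_total i j) => ij e; [|symmetry]; apply: H.
rewrite -(subnK ij) addnC gexpnD // actM => e.
have {}e : act (gexpn p z (j - i)) v = v.
  have := congr1 (act (ginv p (gexpn p z i))) e.
  by rewrite !actK.
have {e} zk : gexpn p z (j - i) = gone p.
  apply: stab_torsion_free n0 _ e.
  by rewrite -gexpnM // mulnC gexpnM // zn gexpn_one.
have : gexpn p z ((j - i) %% n) = gone p.
  move: zk; rewrite {1}(divn_eq (j - i) n) gexpnD // mulnC gexpnM // zn.
  by rewrite gexpn_one // gmul1l.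
have [/eqP d0 _|d0 /nmin[]] := posnP ((j - i) %% n).
  by rewrite -[in LHS](addn0 i) -(modnDmr i (j - i)) (eqP d0).
by rewrite d0 ltn_pmod.
Qed.

(** Within each orbit of [z], [l] counts the steps from a representative; freeness determines this
    count modulo [n]. *)
Lemma exists_labelling z n : gexpn p z n = gone p -> (0 < n)%N ->
  (forall k, (0 < k < n)%N -> gexpn p z k <> gone p) ->
  exists l : V -> nat, forall v, (l (act z v) = (l v).+1 %[mod n])%N.
Proof.
move=> zn n0 nmin.
have [|||R [vR RE]] := @orbit_representative V
  (fun v w => exists k, w = act (gexpn p z k) v).
- by move=> v; exists 0%N; rewrite act1.
(* The exponent [k * n.-1] stands for [-k], since [z^n = 1]. *)
- move=> v w [k ->]; exists (k * n.-1)%N.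
  rewrite -actM -gexpnD // addnC -mulnS prednK // mulnC.
  by rewrite gexpnM // zn gexpn_one.
- move=> u v w [k ->] [k' ->]; exists (k' + k)%N.
  by rewrite gexpnD // actM.
have /choice[l lE] : forall v, exists k, v = act (gexpn p z k) (R v).
  move=> v; have [k ->] := vR v.
  exists (k * n.-1)%N; rewrite -actM -gexpnD // -mulnSr prednK // mulnC.
  by rewrite gexpnM // zn gexpn_one.
exists l => v; apply: (@act_expn_inj z n _ _ (R v)) => //.
rewrite gexpnS actM -lE.
have -> : R v = R (act z v) by apply: RE; exists 1%N; rewrite gexpn1.
by rewrite -lE.
Qed.

(* If z has finite order n > 1, label the vertices by l : V -> Z/n with
   l (z v) = l v + 1. The function m (v, w) = l w - l v on edges is z-invariant,
   so a torsion chain c over z pairs to 0 with it; but modulo n that pairing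
   is l (z v0) - l v0 = 1. *)
Lemma path_chains_torsion_free : torsion_free_on chain_ops path_chains.
Proof.
move=> [a z] N [/= aD ad] N0 eN.
have zN : gexpn p z N = gone p by rewrite -(chain_expn (a, z)) eN.
have inv0 m : shift z m = m -> a m = 0%R.
  move=> zm; have := @chain_expn_shift (a, z) N m zm; rewrite eN /= => /esym/eqP.
  by rewrite mulrn_eq0 eqn0Ngt N0 /= => /eqP.
pose Q n := (0 < n)%N && `[< gexpn p z n = gone p >].
have exQ : exists n, Q n by exists N; rewrite /Q N0; apply/asboolP.
case: (ex_minnP exQ) => n /andP[n0 /asboolP zn] nmin.
have {}nmin k : (0 < k < n)%N -> gexpn p z k <> gone p.
  move=> /andP[k0 kn] zk; have : Q k by rewrite /Q k0; apply/asboolP.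
  by move=> /nmin; rewrite leqNgt kn.
(* If [z] is trivial, every edge function is invariant and the chain vanishes. *)
have [n1|n1] := leqP n 1.
  have z1 : z = gone p by rewrite -(gexpn1 Gp z) -zn; congr gexpn; lia.
  by congr (_, _) => //; apply/funext => m; rewrite inv0 // z1 shift1.
have [l lE] := exists_labelling zn n0 nmin.
pose L v := Posz (l v).
(* Division of [delta L] by [n]: the remainder [m] is invariant, so it pairs to 0, and the rest
   pairs to a multiple of [n]. *)
pose m (e : V * V) := modz (L e.2 - L e.1)%R n.
pose q (e : V * V) := divz (L e.2 - L e.1)%R n.
have aMn k : a (fun e => q e * k%:Z)%R = (a q * k%:Z)%R.
  have a0 : a (fun=> 0%R) = 0%R.
    have := aD (fun=> 0%R) (fun=> 0%R).
    by rewrite (_ : (fun _ => _) = (fun=> 0%R)); [lia|apply/funext => e; rewrite addr0].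
  elim: k => [|k IH].
    by rewrite mulr0 -a0; congr a; apply/funext => e; rewrite mulr0.
  have -> : (fun e => q e * k.+1%:Z)%R = (fun e => q e * k%:Z + q e)%R.
    by apply/funext => e; lia.
  by rewrite aD IH; lia.
have lz v : (L (act z v) = L v + 1 %[mod n])%Z.
  by rewrite /L !modz_nat lE -addn1.
have zm : shift z m = m.
  apply/funext => -[v w]; rewrite /shift /m /=.
  rewrite -modzDm -modzNm !lz modzNm modzDm.
  by congr modz; ring.
have := ad L.
have -> : delta L = (fun e => m e + q e * n%:Z)%R.
  by apply/funext => e; rewrite /delta /m /q [RHS]addrC -divz_eq.
(* Modulo [n] the left side is 0 and the right side is 1, although [n > 1]. *)
rewrite aD inv0 // aMn add0r => /(congr1 (modz^~ n)).
rewrite modzMl -modzDml lz modzDml addrAC subrr add0r.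
by rewrite modz_nat modn_small.
Qed.

End StableLetter.

(** * Torsion-free extensions *)

(** The extension proper is the subgroup [S]; the ambient group may have torsion, as the group of
    all pairs of a chain and an element of [P] does when [P] has. *)
Definition torsion_free_extension (T : Type) (o : grp_ops T) (E : Type)
    (oE : grp_ops E) (S : set E) (i : T -> E) : Prop :=
  [/\ is_group oE, subgroup oE S, torsion_free_on oE S, group_hom o oE i
    & injective i /\ forall x, S (i x)].

Lemma sval_inj (T : Type) (A : T -> Prop) (x y : {t | A t}) :
  sval x = sval y -> x = y.
Proof.
by case: x y => [x Ax] [y Ay] /= e; subst y; congr exist; apply: Prop_irrelevance.
Qed.

(* For P containing a torsion-free group T, the element t lifts tau; it carries
   the edge from v0 to tau v0, where v0 is the trivial coset in P / T. *)
Lemma stable_letter_extension (T : Type) (o : grp_ops T) (P : Type)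
    (p : grp_ops P) (i : T -> P) (tau : P) :
    is_group o -> torsion_free o -> is_group p -> group_hom o p i ->
    injective i ->
  exists (E : Type) (oE : grp_ops E) (S : set E) (j : T -> E) (t : E),
    [/\ torsion_free_extension o oE S j, S t & forall x y,
        gmul p tau (i x) = gmul p (i y) tau ->
        gmul oE t (j x) = gmul oE (j y) t].
Proof.
move=> Go tf Gp iM i_inj.
pose coset q : set P := [set r | exists g, r = gmul p q (i g)].
pose V := {A : set P | exists q, A = coset q}.
have actP z (A : V) : exists q, [set r | sval A (gmul p (ginv p z) r)] = coset q.
  case: A => A /= [q ->]; exists (gmul p z q); apply/seteqP; split=> r [g e].
    by exists g; rewrite -(gmulVKl Gp z r) e gmulA.
  by exists g; rewrite e -(gmulA Gp z) gmulKl.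
pose act z A : V := exist _ _ (actP z A).
have act1 v : act (gone p) v = v.
  apply: sval_inj; apply/seteqP; split=> r /=;
  by rewrite (ginv1 Gp) (gmul1l Gp).
have actM z w v : act (gmul p z w) v = act z (act w v).
  by apply: sval_inj; apply/seteqP; split=> r /=; rewrite (ginvM Gp) (gmulA Gp).
pose v0 : V := exist _ (coset (gone p)) (ex_intro _ _ erefl).
have actv0 g : act (i g) v0 = v0.
  apply: sval_inj; apply/seteqP; split=> r /= [g' e].
    by exists (gmul o g g'); rewrite -(gmulVKl Gp (i g) r) e !gmul1l // iM.
  exists (gmul o (ginv o g) g'); rewrite e !gmul1l // iM.
  by rewrite (homV Go Gp iM).
(* An element fixing the coset of [q] is the conjugate by [q] of some [i g]; if it has finite order,
   then [g] is trivial because [T] is torsion-free. *)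
have stab z v n : (0 < n)%N -> gexpn p z n = gone p -> act z v = v -> z = gone p.
  case: v => A [q Aq] n0 zn /(congr1 sval) /= zA.
  have : A (gmul p z q).
    by rewrite -zA /= gmulKl // Aq; exists (gone o); rewrite (hom1 Go Gp iM) gmul1.
  rewrite Aq => -[g zq].
  pose conj (r : P) := gmul p (gmul p q r) (ginv p q).
  have conjM : group_hom p p conj.
    by move=> a b; rewrite /conj !(gmulA Gp) (gmulKV Gp).
  have {zq} zg : z = conj (i g) by rewrite /conj -zq gmulK.
  move: zn; rewrite zg -(homXn Gp Gp conjM) -(homXn Go Gp iM) => e.
  have : i (gexpn o g n) = i (gone o).
    rewrite (hom1 Go Gp iM); apply: (gmulIl Gp (x := q)).
    by apply: (gmulIr Gp (x := ginv p q)); rewrite gmul1 // gmulV.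
  by move=> /i_inj /(tf g n n0) ->; rewrite (hom1 Go Gp iM) (hom1 Gp Gp conjM).
pose j g := ((fun=> 0%R) : (V * V -> int) -> int, i g).
pose t := ((fun m => m (v0, act tau v0)) : (V * V -> int) -> int, tau).
exists (((V * V -> int) -> int) * P)%type, (chain_ops p act).
exists (path_chains act v0), j, t.
split.
- split.
  + exact: chain_ops_group.
  + exact: path_chains_subgroup.
  + exact: path_chains_torsion_free.
  + by move=> x y; congr (_, _); exact: iM.
  + split=> [x y /(congr1 snd)/i_inj//|x].
    by split=> [m m'|l] /=; rewrite ?addr0 // actv0 subrr.
- by split.
(* The chains agree too: [i y] fixes [v0] and sends [tau v0] to [tau (i x) v0], which is
   [tau v0]. *)
move=> x y e; congr (_, _) => //=; apply/funext => m.
by rewrite addr0 add0r actv0 -actM -e actM actv0.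
Qed.

(** * Symmetric groups *)

Section Permutations.
Variable X : Type.

(** Each bijection carries its inverse, so that inversion only swaps two functions. *)
Definition permutation : Type :=
  {f : (X -> X) * (X -> X) | cancel f.1 f.2 /\ cancel f.2 f.1}.

Lemma perm_mulP (f g : permutation) :
  cancel ((sval f).1 \o (sval g).1) ((sval g).2 \o (sval f).2) /\
  cancel ((sval g).2 \o (sval f).2) ((sval f).1 \o (sval g).1).
Proof.
by case: f g => [f [fK fK']] [g [gK gK']]; split; apply: can_comp.
Qed.
Lemma perm_invP (f : permutation) :
  cancel (sval f).2 (sval f).1 /\ cancel (sval f).1 (sval f).2.
Proof. by case: f => f []. Qed.
Lemma perm_oneP : cancel (@id X) id /\ cancel (@id X) id. Proof. by []. Qed.

Definition perm_ops : grp_ops permutation := GrpOps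
  (fun f g => exist _ (_, _) (perm_mulP f g))
  (fun f => exist _ (_, _) (perm_invP f))
  (exist _ (id, id) perm_oneP).

Lemma perm_ops_group : is_group perm_ops.
Proof.
split=> [f g h|f|f|[f [fK fK']]|[f [fK fK']]]; apply: sval_inj => //=.
- by case: f => [[]].
- by case: f => [[]].
- by congr (_, _); apply/funext => x /=; rewrite fK.
- by congr (_, _); apply/funext => x /=; rewrite fK'.
Qed.
End Permutations.

(** * Making two elements conjugate *)

Section Conjugation.
Variables (T : Type) (o : grp_ops T) (Go : is_group o) (tf : torsion_free o).
Local Notation "x * y" := (gmul o x y).

(** [r] picks a representative of each right coset of the group generated by [x]; the exponent [e]
    is unique because [x] has infinite order. *)
Lemma cyclic_transversal x : x <> gone o ->
  exists (e : T -> int) (r : T -> T), [/\ forall u, gexpz o x (e u) * r u = u,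
    forall k u, e (gexpz o x k * u) = (k + e u)%R
    & forall k u, r (gexpz o x k * u) = r u].
Proof.
move=> x1.
have [|||r [rP rE]] := @orbit_representative T
  (fun u v => exists k, u = gexpz o x k * v).
- by move=> u; exists 0%R; rewrite gmul1l.
- by move=> u v [k ->]; exists (- k)%R; rewrite gexpzN // gmulKl.
- by move=> u v w [k ->] [l ->]; exists (k + l)%R; rewrite gexpzD // gmulA.
have {}rE k u : r (gexpz o x k * u) = r u by apply: rE; exists k.
have /choice[e eP] : forall u, exists k, gexpz o x k * r u = u.
  by move=> u; have [k uE] := rP u; exists k.
exists e, r; split=> // k u; apply: (gexpz_inj Go tf x1).
by apply: (gmulIr Go (x := r u)); rewrite -{1}(rE k u) eP gexpzD // -gmulA // eP.
Qed.

(* With T = <x> A = <y> B for transversals A and B, the formula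
   (x^i a, y^j b) |-> (y^i b, x^j a) defines a permutation of T * T that
   conjugates left translation by x to left translation by y. *)
Lemma conjugating_extension x y : x <> gone o -> y <> gone o ->
  exists (E : Type) (oE : grp_ops E) (S : set E) (j : T -> E) (t : E),
    [/\ torsion_free_extension o oE S j, S t
      & gmul oE t (j x) = gmul oE (j y) t].
Proof.
move=> x1 y1.
have [e [r [er eM rM]]] := cyclic_transversal x1.
have [e' [r' [er' eM' rM']]] := cyclic_transversal y1.
have e0 u : e (r u) = 0%R by have := congr1 e (er u); rewrite eM; lia.
have e0' u : e' (r' u) = 0%R by have := congr1 e' (er' u); rewrite eM'; lia.
have rr u : r (r u) = r u by have := congr1 r (er u); rewrite rM.
have rr' u : r' (r' u) = r' u by have := congr1 r' (er' u); rewrite rM'.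
(* A second factor [T] is needed to match orbits: in [T] alone the groups generated by [x] and [y]
   can have different indices, as for 1 and 2 in the integers. *)
pose f (u : T * T) := (gexpz o y (e u.1) * r' u.2, gexpz o x (e' u.2) * r u.1).
pose f' (u : T * T) := (gexpz o x (e' u.1) * r u.2, gexpz o y (e u.2) * r' u.1).
have fK : cancel f f'.
  by move=> [u v]; rewrite /f /f' /= eM rM eM' rM' e0 e0' !addr0 rr rr' er er'.
have fK' : cancel f' f.
  by move=> [u v]; rewrite /f /f' /= eM rM eM' rM' e0 e0' !addr0 rr rr' er er'.
have iP g : cancel (fun u : T * T => (g * u.1, u.2))
                   (fun u => (ginv o g * u.1, u.2)) /\
            cancel (fun u : T * T => (ginv o g * u.1, u.2))
                   (fun u => (g * u.1, u.2)).
  by split=> -[u v] /=; rewrite ?gmulKl ?gmulVKl.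
pose i g : permutation (T * T)%type := exist _ (_, _) (iP g).
have [||E [oE [S [j [t [H St Ht]]]]]] := @stable_letter_extension T o
  (permutation (T * T)%type) (@perm_ops _) i (exist _ (f, f') (conj fK fK')) Go tf
  (@perm_ops_group _).
- move=> a b; apply: sval_inj; congr (_, _); apply/funext => -[u v] /=.
    by rewrite gmulA.
  by rewrite ginvM // gmulA.
- move=> a b /(congr1 (fun s => ((sval s).1 (gone o, gone o)).1)) /=.
  by rewrite !gmul1.
exists E, oE, S, j, t; split=> //; apply: Ht; apply: sval_inj.
congr (_, _); apply/funext => -[u v].
  rewrite /f /= -{1}(gexpz1 Go x) -{3}(gexpz1 Go x) eM rM gexpzD // gexpz1 //.
  by rewrite gmulA.
rewrite /f' /= -(gexpz1 Go y) -gexpzN // eM' rM' gexpzD // gexpzN // !gexpz1 //.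
by rewrite gmulA.
Qed.
End Conjugation.

(** * Heisenberg group and wreath products *)

(** The triple [(a, b, c)] is the unitriangular integer matrix of size 3 with [a] and [b] above the
    diagonal and [c] in the corner. *)
Definition heis_ops : grp_ops (int * int * int)%type := GrpOps
  (fun x y => (x.1.1 + y.1.1, x.1.2 + y.1.2, x.2 + y.2 + x.1.1 * y.1.2)%R)
  (fun x => (- x.1.1, - x.1.2, - x.2 + x.1.1 * x.1.2)%R)
  (0, 0, 0)%R.

Lemma heis_group : is_group heis_ops.
Proof.
split=> [[[a b] c] [[a' b'] c'] [[a'' b''] c'']|[[a b] c]|[[a b] c]|[[a b] c]|[[a b] c]] /=;
  by do ?congr (_, _); ring.
Qed.

(** The first two coordinates are additive, and once they vanish so is the third. *)
Lemma heis_torsion_free : torsion_free heis_ops.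
Proof.
move=> [[a b] c] n n0 xn.
have nz (k : int) : (k *+ n = 0 -> k = 0)%R.
  by move=> /eqP; rewrite mulrn_eq0 eqn0Ngt n0 /= => /eqP.
have a0 : a = 0%R.
  apply: nz; have := congr1 (fun x => x.1.1) xn => /= <-.
  by elim: (n) => // k IH; rewrite gexpnS /= -IH mulrS.
have b0 : b = 0%R.
  apply: nz; have := congr1 (fun x => x.1.2) xn => /= <-.
  by elim: (n) => // k IH; rewrite gexpnS /= -IH mulrS.
congr (_, _, _) => //.
apply: nz; have := congr1 snd xn => /= <-.
by elim: (n) => // k IH; rewrite gexpnS /= -IH mulrS a0 mul0r addr0.
Qed.

Section Wreath.
Variables (T : Type) (o : grp_ops T) (Go : is_group o) (tf : torsion_free o).
Variables (B : Type) (b : grp_ops B) (Gb : is_group b) (tfb : torsion_free b).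

(** [T] acts on functions by left translation. Infinite supports are allowed, since functions
    supported on a whole cyclic subgroup are used below. *)
Definition wreath_ops : grp_ops ((T -> B) * T)%type := GrpOps
  (fun x y => (fun u => gmul b (x.1 u) (y.1 (gmul o (ginv o x.2) u)),
               gmul o x.2 y.2))
  (fun x => (fun u => ginv b (x.1 (gmul o x.2 u)), ginv o x.2))
  (fun=> gone b, gone o).

Lemma wreath_group : is_group wreath_ops.
Proof.
split.
- move=> [f x] [g y] [h z]; congr (_, _) => /=; last exact: gmulA.
  by apply/funext => u; rewrite gmulA // ginvM // gmulA.
- move=> [f x]; congr (_, _) => /=; last exact: gmul1l.
  by apply/funext => u; rewrite gmul1l // ginv1 // gmul1l.
- move=> [f x]; congr (_, _) => /=; last exact: gmul1.
  by apply/funext => u; rewrite gmul1.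
- move=> [f x]; congr (_, _) => /=; last exact: gmulVl.
  by apply/funext => u; rewrite ginvK // gmulVl.
- move=> [f x]; congr (_, _) => /=; last exact: gmulV.
  by apply/funext => u; rewrite gmulVKl // gmulV.
Qed.

Lemma wreath_base_expn (f : T -> B) n :
  gexpn wreath_ops (f, gone o) n = (fun u => gexpn b (f u) n, gone o).
Proof.
elim: n => // n IH; rewrite gexpnS IH; congr (_, _) => /=; last exact: gmul1.
by apply/funext => u; rewrite ginv1 // gmul1l.
Qed.

Lemma wreath_torsion_free : torsion_free wreath_ops.
Proof.
move=> [f x] n n0 xn.
have x1 : x = gone o.
  apply: (tf (n := n)) => //; have := congr1 snd xn => /= <-.
  by elim: (n) => // k IH; rewrite !gexpnS /= -IH.
move: xn; rewrite x1 wreath_base_expn => -[fn].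
congr (_, _); apply/funext => u; apply: (tfb (n := n)) => //.
exact: (congr1 (@^~ u) fn).
Qed.

Lemma wreath_base_gcomm (f g : T -> B) :
  gcomm wreath_ops (f, gone o) (g, gone o) =
  (fun u => gcomm b (f u) (g u), gone o).
Proof.
congr (_, _) => /=; last by rewrite !ginv1 // !gmul1.
by apply/funext => u; rewrite /= !(ginv1, gmul1l).
Qed.
End Wreath.

(* a and b are constant functions T -> Heis cut off outside <g>; b and its
   conjugate by h have disjoint supports when h is not in <g>, so
   [a, [b, h]] = [a, b]. *)
Lemma centralizing_extension (T : Type) (o : grp_ops T) (g : T) :
    is_group o -> torsion_free o ->
  exists (E : Type) (oE : grp_ops E) (j : T -> E) (a b : E),
    [/\ torsion_free_extension o oE setT j, gcommute oE a (j g),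
        gcommute oE b (j g) & forall h, ~ (exists z, h = gexpz o g z) ->
        [/\ gcomm oE a (gcomm oE b (j h)) <> gone oE,
            gcommute oE (gcomm oE a (gcomm oE b (j h))) (j g)
          & ~ gcommute oE (gexpn oE a 12) (j h)]].
Proof.
move=> Go tf; set w := wreath_ops o heis_ops.
have Gw : is_group w by apply: wreath_group => //; exact: heis_group.
pose cyc u := exists z, u = gexpz o g z.
pose j x : (T -> int * int * int) * T := (fun=> gone heis_ops, x).
pose ind c u : int * int * int := if `[< cyc u >] then c else gone heis_ops.
pose base c : (T -> int * int * int) * T := (ind c, gone o).
have jM : group_hom o w j.
  by move=> x y; congr (_, _); apply/funext => u; rewrite gmul1 //; exact: heis_group.
have cycg u : cyc (gmul o (ginv o g) u) = cyc u.
  rewrite propeqE; split=> -[z uz]; last first.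
    by exists (z - 1)%R; rewrite uz gexpzP.
  by exists (z + 1)%R; rewrite gexpzS // -uz gmulVKl.
have base_comm c : gcommute w (base c) (j g).
  congr (_, _); last by rewrite /= gmul1 // gmul1l.
  apply/funext => u; transitivity (ind c u); first exact: (gmul1 heis_group).
  by rewrite {1}/ind -cycg; exact/esym/(gmul1l heis_group).
(* Two Heisenberg generators, whose commutator [(0, 0, 1)] is nontrivial. *)
exists ((T -> int * int * int) * T)%type, w, j, (base (1, 0, 0)%R), (base (0, 1, 0)%R).
split; [|exact: base_comm|exact: base_comm|move=> h hg].
  split=> //.
  - by move=> x n _; apply: (wreath_torsion_free Go tf heis_torsion_free).
  - by split=> // x y [].
have not_cyc u : cyc u -> ~ cyc (gmul o (ginv o h) u).
  move=> [z uz] [z' hu]; apply: hg; exists (z - z')%R.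
  by rewrite gexpzD // gexpzN // -hu -uz ginvM // ginvK // gmulVKl.
have conj_h c : gmul w (gmul w (j h) (base c)) (ginv w (j h)) =
    (fun u => ind c (gmul o (ginv o h) u), gone o).
  congr (_, _); last by rewrite /= gmul1 // gmulV.
  apply/funext => u; transitivity (gmul heis_ops (gmul heis_ops (gone heis_ops)
    (ind c (gmul o (ginv o h) u))) (ginv heis_ops (gone heis_ops))) => //.
  by rewrite (ginv1 heis_group) (gmul1 heis_group) (gmul1l heis_group).
have cyc1 : cyc (gone o) by exists 0%R.
have bh : gcomm w (base (0, 1, 0)%R) (j h) =
    (fun u => gmul heis_ops (ind (0, 1, 0)%R u)
       (ginv heis_ops (ind (0, 1, 0)%R (gmul o (ginv o h) u))), gone o).
  have -> : gcomm w (base (0, 1, 0)%R) (j h) = gmul w (base (0, 1, 0)%R)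
      (ginv w (gmul w (gmul w (j h) (base (0, 1, 0)%R)) (ginv w (j h)))).
    by rewrite /gcomm !ginvM // ginvK // !gmulA.
  rewrite conj_h; congr (_, _) => /=; last by rewrite ginv1 // gmul1.
  by apply/funext => u; rewrite ginv1 // !gmul1l.
have abh : gcomm w (base (1, 0, 0)%R) (gcomm w (base (0, 1, 0)%R) (j h)) =
    base (0, 0, 1)%R.
  rewrite bh wreath_base_gcomm //; congr (_, _); apply/funext => u.
  (* On the powers of [g] the conjugate of [b] by [h] is trivial, and elsewhere [a] is. *)
  rewrite /ind; case: asboolP => [/not_cyc cu|_]; first by case: asboolP.
  by apply/(gcomm1P heis_group); apply: gcommute1; exact: heis_group.
rewrite abh; split=> //.
  move=> /(congr1 (fun x => x.1 (gone o))) /=.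
  by rewrite /ind; case: asboolP.
have -> : gexpn w (base (1, 0, 0)%R) 12 = base (12%:Z, 0, 0)%R.
  rewrite wreath_base_expn //; congr (_, _); apply/funext => u.
  by rewrite /ind; case: ifP.
move=> c.
(* If [a^12] commuted with [h] it would equal its conjugate by [h], but at the identity of [T] only
   the former is nontrivial. *)
have : base (12%:Z, 0, 0)%R =
    gmul w (gmul w (j h) (base (12%:Z, 0, 0)%R)) (ginv w (j h)).
  by rewrite -c gmulK.
rewrite conj_h => /(congr1 (fun x => x.1 (gone o))) /=.
by rewrite /ind asboolT // asboolF //; exact: not_cyc.
Qed.

(** * Group structures on nat *)

(** Start from any enumeration and correct one value at a time: [i N] occurs at some [M], and
    [M >= N] since earlier places hold other values, so swapping [N] and [M] keeps what was already
    corrected. *)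
Lemma countable_enumeration (E : Type) (K : set E) (i : nat -> E) (N : nat) :
    countable K -> injective i -> (forall k, K (i k)) ->
  exists j : nat -> E, [/\ injective j, range j = K
    & forall k, (k < N)%N -> j k = i k].
Proof.
move=> Kc i_inj iK.
have infK : ~ finite_set K.
  apply/infiniteP; apply: (@card_le_trans _ _ _ (range i)).
    by have := inj_card_eq (A := setT) (in2W i_inj); rewrite card_eq_le => /andP[].
  by apply: subset_card_le => _ [k _ <-].
have /card_set_bijP[f [_ f_inj f_surj]] := eq_card_nat Kc infK.
have /choice[s sP] : forall n, exists e, K e /\ f e = n.
  by move=> n; have [e Ke <-] := f_surj n I; exists e.
elim: N => [|N [j [j_inj jK jN]]].
  exists s; split=> //; first by move=> m n e; rewrite -(sP m).2 e (sP n).2.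
  apply/seteqP; split=> [_ [n _ <-]|e Ke]; first exact: (sP n).1.
  exists (f e) => //; apply: f_inj; rewrite ?inE //; first exact: (sP _).1.
  exact: (sP _).2.
have [M _ jM] : range j (i N) by rewrite jK.
have NM : (N <= M)%N.
  rewrite leqNgt; apply/negP => MN.
  by have := jN _ MN; rewrite jM => /i_inj e; rewrite e ltnn in MN.
pose sw k := if k == N then M else if k == M then N else k.
have swK : involutive sw.
  move=> k; rewrite /sw; case: (eqVneq k N) => [->|kN].
    by case: (eqVneq M N) => [->|_]; rewrite ?eqxx.
  case: (eqVneq k M) => [->|kM]; first by rewrite eqxx.
  by rewrite (negPf kN) (negPf kM).
exists (j \o sw); split.
- by apply: inj_comp => //; apply: can_inj swK.
- rewrite -jK; apply/seteqP; split=> _ [k _ <-]; first by exists (sw k).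
  by exists (sw k) => //=; rewrite swK.
move=> k; rewrite ltnS leq_eqVlt /= /sw => /orP[/eqP ->|kN]; first by rewrite eqxx.
by rewrite !ifN_eq ?jN //; lia.
Qed.

(** [N] exceeds every number mentioned by [agree n], so an enumeration that follows an embedding
    below [N] reproduces that part of the tables. *)
Lemma coordinates_bounded (o : grp_ops nat) n : exists N, forall a b,
  (a <= n)%N -> (b <= n)%N -> [/\ (a < N)%N, (gmul o a b < N)%N,
    (ginv o a < N)%N & (gone o < N)%N].
Proof.
exists (n + gone o + \max_(a < n.+1) ginv o a +
  \max_(a < n.+1) \max_(b < n.+1) gmul o a b).+1%N => a b an bn.
have /= ia := leq_bigmax (F := fun a : 'I_n.+1 => ginv o a) (Ordinal (an : (a < n.+1)%N)).
have /= ma := leq_bigmax (F := fun a : 'I_n.+1 => \max_(b < n.+1) gmul o a b)%N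
  (Ordinal (an : (a < n.+1)%N)).
have /= mb := leq_bigmax (F := fun b : 'I_n.+1 => gmul o a b)
  (Ordinal (bn : (b < n.+1)%N)).
by split; lia.
Qed.

(** The images of [i] and [s] generate a countable subgroup [K] of [S]; its operations are
    transported to [nat] by an enumeration that keeps the names used by [agree n]. *)
Lemma realize_extension (o : grp_ops nat) (n : nat) (E : Type)
    (oE : grp_ops E) (S : set E) (i : nat -> E) (s : nat -> E) :
    Gtf o -> torsion_free_extension o oE S i -> (forall k, S (s k)) ->
  exists (o' : grp_ops nat) (j : nat -> E),
    [/\ Gtf o', agree n o o', group_hom o' oE j & injective j] /\
    [/\ forall k, (k <= n)%N -> j k = i k & forall k, exists l, j l = s k].
Proof.
move=> [Go _] [GE [S1 SM SV] tfS iM [i_inj iS]] sS.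
pose gen (c : nat + nat) := match c with inl k => i k | inr k => s k end.
pose letter (c : (nat + nat) * bool) := if c.2 then gen c.1 else ginv oE (gen c.1).
pose ev (w : seq ((nat + nat) * bool)) :=
  foldr (fun c e => gmul oE (letter c) e) (gone oE) w.
pose K := range ev.
have ev_cat v w : ev (v ++ w) = gmul oE (ev v) (ev w).
  by elim: v => [|c v IH] /=; rewrite ?gmul1l // IH gmulA.
have KM x y : K x -> K y -> K (gmul oE x y).
  by move=> [v _ <-] [w _ <-]; exists (v ++ w).
have KV x : K x -> K (ginv oE x).
  move=> [v _ <-]; exists (rev [seq (c.1, ~~ c.2) | c <- v]) => //.
  elim: v => [|c v IH]; first by rewrite /= ginv1.
  rewrite map_cons rev_cons -cats1 ev_cat IH /= gmul1 // ginvM //.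
  by congr gmul; case: c => c [] /=; rewrite /letter //= ginvK.
have KS x : K x -> S x.
  move=> [w _ <-]; elim: w => //= c w IH; apply: SM => //.
  have gS : S (gen c.1) by case: c.1.
  by rewrite /letter; case: ifP => // _; apply: SV.
have Kgen c : K (gen c) by exists [:: (c, true)] => //=; rewrite gmul1.
have [N NP] := coordinates_bounded o n.
have [|j [j_inj jK jN]] := @countable_enumeration E K i N _ i_inj (fun k => Kgen (inl k)).
  by apply: sub_countable (card_image_le _ _) _.
have jP k : K (j k) by rewrite -jK; exists k.
(* [r] inverts [j] on [K]; elsewhere its value is irrelevant. *)
have /choice[r rP] : forall e, exists k, K e -> j k = e.
  move=> e; have [Ke|nKe] := pselect (K e); last by exists 0%N.
  by move: (Ke); rewrite -jK => -[k _ <-]; exists k.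
have jr e : K e -> j (r e) = e by exact: rP.
have rj k : r (j k) = k by apply: j_inj; apply: jr.
pose o' := GrpOps (fun a b => r (gmul oE (j a) (j b)))
  (fun a => r (ginv oE (j a))) (r (gone oE)).
have K1 : K (gone oE) by exists [::].
have jM : group_hom o' oE j by move=> a b; apply/jr/KM.
have jV a : j (ginv o' a) = ginv oE (j a) by apply/jr/KV.
have j1 : j (gone o') = gone oE by apply: jr.
have Go' : is_group o'.
  split=> [a b c|a|a|a|a]; apply: j_inj;
  by rewrite ?(jM, jV, j1, gmulA GE, gmul1l GE, gmul1 GE, gmulVl GE, gmulV GE).
exists o', j; split; split=> //.
- split=> // x m m0 /(congr1 j); rewrite (homXn Go' GE jM) j1 => xm.
  by apply: j_inj; rewrite j1; apply: tfS m0 xm; apply: KS.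
- split=> [a b an bn|a an|].
  + have [aN abN _ _] := NP a b an bn; have [bN _ _ _] := NP b a bn an.
    by apply: j_inj; rewrite jM !jN // iM.
  + have [aN _ vN _] := NP a a an an.
    by apply: j_inj; rewrite jV !jN // (homV Go GE iM).
  + have [_ _ _ oN] := NP 0%N 0%N isT isT.
    by apply: j_inj; rewrite j1 jN // (hom1 Go GE iM).
- by move=> k kn; have [kN _ _ _] := NP k k kn kn; apply: jN.
- by move=> k; exists (r (s k)); apply: jr; apply: (Kgen (inr k)).
Qed.

(** * Locally constant functions of the group structure *)

(** Continuity into the discrete space [A]; for [A = Prop] it says that the set defined by [F] is
    clopen. *)
Definition locally_constant (A : Type) (F : grp_ops nat -> A) : Prop :=
  forall o, exists n, forall o', agree n o o' -> F o' = F o.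

Lemma agree_le m n o o' : (m <= n)%N -> agree n o o' -> agree m o o'.
Proof.
move=> mn [H1 H2 H3]; split=> // [i j im jm|i im].
  by apply: H1; apply: leq_trans mn.
by apply: H2; apply: leq_trans mn.
Qed.

Lemma locally_constant_cst (A : Type) (a : A) : locally_constant (fun=> a).
Proof. by move=> o; exists 0%N. Qed.

Lemma locally_constant_pair (A B C : Type) (f : A -> B -> C) F G :
  locally_constant F -> locally_constant G ->
  locally_constant (fun o => f (F o) (G o)).
Proof.
move=> HF HG o; have [m Hm] := HF o; have [n Hn] := HG o.
exists (maxn m n) => o' a; rewrite Hm ?Hn //; apply: agree_le a;
[exact: leq_maxr|exact: leq_maxl].
Qed.

Lemma locally_constant_one : locally_constant (@gone nat).
Proof. by move=> o; exists 0%N => o' []. Qed.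

Lemma locally_constant_mul F G : locally_constant F -> locally_constant G ->
  locally_constant (fun o => gmul o (F o) (G o)).
Proof.
move=> HF HG o; have [m Hm] := HF o; have [n Hn] := HG o.
(* The bound also covers [F o] and [G o], the place where the multiplication table is read. *)
exists (maxn (maxn m n) (maxn (F o) (G o))) => o' a.
rewrite Hm ?Hn; try by apply: agree_le a; lia.
by case: a => /(_ (F o) (G o)) ->; lia.
Qed.

Lemma locally_constant_inv F : locally_constant F ->
  locally_constant (fun o => ginv o (F o)).
Proof.
move=> HF o; have [m Hm] := HF o.
exists (maxn m (F o)) => o' a.
rewrite Hm; last by apply: agree_le a; lia.
by case: a => _ /(_ (F o)) ->; lia.
Qed.

Lemma locally_constant_expn F n : locally_constant F ->
  locally_constant (fun o => gexpn o (F o) n).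
Proof.
move=> HF; elim: n => [|n IH]; first exact: locally_constant_one.
exact: locally_constant_mul.
Qed.

Lemma locally_constant_expz F z : locally_constant F ->
  locally_constant (fun o => gexpz o (F o) z).
Proof.
by move=> HF; case: z => n; [|apply: locally_constant_inv];
  apply: locally_constant_expn.
Qed.

Lemma locally_constant_gcomm F G : locally_constant F -> locally_constant G ->
  locally_constant (fun o => gcomm o (F o) (G o)).
Proof.
move=> HF HG; apply: locally_constant_mul; last exact: locally_constant_inv.
apply: locally_constant_mul; last exact: locally_constant_inv.
exact: locally_constant_mul.
Qed.

Lemma locally_constant_commute F G : locally_constant F -> locally_constant G ->
  locally_constant (fun o => gcommute o (F o) (G o)).
Proof.
by move=> HF HG; apply: locally_constant_pair; apply: locally_constant_mul.
Qed.

(** * Generic conditions *)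

(** The witness is a parameter, so that each condition is clopen and its existential closure is
    open. *)
Definition conj_witness (x y t : nat) (o : grp_ops nat) : Prop :=
  x = gone o \/ y = gone o \/ gmul o t x = gmul o y t.

(** The triple [c] holds the exponent for the case that [h] is a power of [g], then [a], then
    [b]. *)
Definition cent_witness (g h : nat) (c : int * nat * nat) (o : grp_ops nat)
  : Prop :=
  h = gexpz o g c.1.1 \/
  ((gcommute o c.1.2 g /\ gcommute o c.2 g) /\
   (~ (gcomm o c.1.2 (gcomm o c.2 h) = gone o) /\
    gcommute o (gcomm o c.1.2 (gcomm o c.2 h)) g) /\
   ~ gcommute o (gexpn o c.1.2 12) h).

Lemma locally_constant_conj_witness x y t : locally_constant (conj_witness x y t).
Proof.
have lc (k : nat) := @locally_constant_cst _ k; have lc1 := locally_constant_one.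
do 2 (apply: locally_constant_pair; first exact: locally_constant_pair).
by apply: locally_constant_pair; apply: locally_constant_mul.
Qed.

Lemma locally_constant_cent_witness g h c : locally_constant (cent_witness g h c).
Proof.
have lc (k : nat) := @locally_constant_cst _ k; have lc1 := locally_constant_one.
have lcR := locally_constant_gcomm (lc c.1.2) (locally_constant_gcomm (lc c.2) (lc h)).
have lcN F : locally_constant F -> locally_constant (fun o => ~ F o).
  move=> HF.
  exact: (@locally_constant_pair _ _ _ (fun A (_ : nat) => ~ A) F _ HF (lc 0%N)).
apply: locally_constant_pair; first exact/locally_constant_pair/locally_constant_expz.
apply: locally_constant_pair.
  by apply: locally_constant_pair; apply: locally_constant_commute.
apply: locally_constant_pair.
  apply: locally_constant_pair; first by apply/lcN/locally_constant_pair.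
  exact: locally_constant_commute.
by apply/lcN/locally_constant_commute => //; apply: locally_constant_expn.
Qed.

Lemma open_in_Gtf_exists (A : Type) (Q : A -> grp_ops nat -> Prop) :
  (forall a, locally_constant (Q a)) ->
  open_in_Gtf [set o | Gtf o /\ exists a, Q a o].
Proof.
move=> HQ; split=> [? [] //|o [_ [a Qa]]].
have [n Hn] := HQ a o; exists n => o' Go' oo'; split=> //.
by exists a; rewrite Hn.
Qed.

Lemma dense_conj_witness x y :
  dense_in_Gtf [set o | Gtf o /\ exists t, conj_witness x y t o].
Proof.
move=> o n tfo; have [Go tf] := tfo.
have [x1|x1] := pselect (x = gone o).
  by exists o; split=> //; split=> //; exists 0%N; left.
have [y1|y1] := pselect (y = gone o).
  by exists o; split=> //; split=> //; exists 0%N; right; left.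
have [E [oE [S [i [t [HE St e]]]]]] := conjugating_extension Go tf x1 y1.
(* The bound is raised to [x] and [y] so that they keep their names. *)
have [ o' [j [[Go' oo' jM j_inj] [ji jt]]]] :=
  @realize_extension o (maxn n (maxn x y)) E oE S i (fun=> t) tfo HE (fun=> St).
exists o'; split=> //; first by apply: agree_le oo'; lia.
split=> //; have [l lt] := jt 0%N; exists l; right; right.
by apply: j_inj; rewrite !jM lt !ji //; lia.
Qed.

Lemma dense_cent_witness g h :
  dense_in_Gtf [set o | Gtf o /\ exists c, cent_witness g h c o].
Proof.
move=> o n tfo; have [Go tf] := tfo.
have [[z hz]|hg] := pselect (exists z, h = gexpz o g z).
  by exists o; split=> //; split=> //; exists (z, 0%N, 0%N); left.
have [E [oE [i [a [b [HE ag bg /(_ h hg)[abh1 abh ah]]]]]]] :=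
  centralizing_extension g Go tf.
have [ o' [j [[tfo' oo' jM j_inj] [ji jt]]]] :=
  @realize_extension o (maxn n (maxn g h)) E oE setT i
    (fun k => if k == 0%N then a else b) tfo HE (fun=> I).
have GE : is_group oE by case: HE.
have Go' : is_group o' by case: tfo'.
exists o'; split=> //; first by apply: agree_le oo'; lia.
split=> //; have [/= l la] := jt 0%N; have [/= m mb] := jt 1%N.
have jg : j g = i g by apply: ji; lia.
have jh : j h = i h by apply: ji; lia.
have jR := homR Go' GE jM.
exists (0%R, l, m); right; split; [|split].
- rewrite /=; by split; apply: (inj_hom_commute jM) => //; rewrite ?la ?mb jg.
- rewrite /=; split.
    by move=> /(congr1 j); rewrite !jR (hom1 Go' GE jM) la mb jh.
  by apply: (inj_hom_commute jM) => //; rewrite !jR la mb jh jg.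
- rewrite -[(0%R, l, m).1.2]/l => /(hom_commute jM).
  by rewrite (homXn Go' GE jM) la jh.
Qed.

(** * Locally moving actions *)

Section Actions.
Variables (T : Type) (o : grp_ops T) (Go : is_group o).
Variables (X : topologicalType) (r : T -> X -> X).
Hypothesis rM : forall g h, r (gmul o g h) = r g \o r h.
Hypothesis rC : forall g, continuous (r g).
Hypothesis r1 : r (gone o) = id.
Hypothesis hX : hausdorff_space X.

(** Separate [x] and [f x] by open [A] and [B], and take the points of [A] that [f] sends into
    [B]. *)
Lemma displaced_neighbourhood (f : X -> X) x : continuous f -> f x <> x ->
  exists U, [/\ open U, U x & forall p, U p -> ~ U (f p)].
Proof.
move=> fC /eqP; rewrite eq_sym => fx.
move: hX; rewrite open_hausdorff => /(_ _ _ fx) [[A B]] /= [].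
rewrite !inE => Ax Bx [oA oB AB].
exists (A `&` (f @^-1` B)); split=> //.
  by apply: openI => //; apply: open_comp => // y _; apply: fC.
by move=> p [_ Bp] [Ap _]; have : (A `&` B) (f p) by []; rewrite AB.
Qed.

(** Intersecting the neighbourhoods for the single powers makes the [n + 1] translates of [U] by the
    powers of [f] from 0 to [n] pairwise disjoint. *)
Lemma displaced_by_powers f n x :
    (forall k, (0 < k <= n)%N -> r (gexpn o f k) x <> x) ->
  exists U, [/\ open U, U x
    & forall k p, (0 < k <= n)%N -> U p -> ~ U (r (gexpn o f k) p)].
Proof.
elim: n => [|n IH] fx.
  by exists setT; split=> // [|k p]; [exact: openT|lia].
have [k kn|U [oU Ux UP]] := IH; first by apply: fx; lia.
have [U' [oU' Ux' UP']] := displaced_neighbourhood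
  (@rC (gexpn o f n.+1)) (fx n.+1 (leqnn n.+1)).
exists (U `&` U'); split=> //; first exact: openI.
move=> k p kn [Up Up'] [Uf Uf'].
have [kn'|kn'|kn'] := ltngtP k n.+1; [|lia|by subst k; apply: UP' Uf'].
by apply: UP Uf => //; lia.
Qed.

Let rK g x : r (ginv o g) (r g x) = x.
Proof. by have := rM (ginv o g) g; rewrite (gmulVl Go) r1 => /(congr1 (@^~ x)). Qed.

(* [a, [b, h]] moves only points of the union of U, aU, bU, abU; since it
   commutes with f, it moves all of y, fy, ..., f^4 y if it moves y. As U has
   five disjoint translates under f, and a, b commute with f, the pigeonhole
   principle rules this out. *)
Lemma displaced_gcomm_gcomm (U : set X) f h a b :
    (forall k p, (0 < k <= 4)%N -> U p -> ~ U (r (gexpn o f k) p)) ->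
    (forall x, ~ U x -> r h x = x) ->
    gcommute o a f -> gcommute o b f ->
    gcommute o (gcomm o a (gcomm o b h)) f ->
  r (gcomm o a (gcomm o b h)) = id.
Proof.
move=> Uf hU af bf; set w := gcomm o a _ => wf.
(* The four elements [1], [b], [a] and [a b], indexed for counting. *)
pose C (c : bool * bool) := gmul o (if c.1 then a else gone o)
                                   (if c.2 then b else gone o).
have Cf c : gcommute o (ginv o (C c)) f.
  apply: gcommuteV => //; apply: gcommuteM => //.
    by case: c.1 => //; apply: gcommute1.
  by case: c.2 => //; apply: gcommute1.
have hVU x : ~ U x -> r (ginv o h) x = x.
  by move=> /hU hx; rewrite -{1}hx rK.
have suppw p : r w p <> p -> exists c, U (r (ginv o (C c)) p).
  move=> wp; apply: contrapT => nU; apply: wp.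
  (* The conjugate by [C c] of an element supported in [U] fixes [p], which lies outside the
     translate of [U] by [C c]. *)
  have fix_ c k : (forall x, ~ U x -> r k x = x) ->
      r (gmul o (gmul o (C c) k) (ginv o (C c))) p = p.
    move=> kU; rewrite rM /= (rM (C c) k) /= kU; last by move=> Up; apply: nU; exists c.
    by have := rK (ginv o (C c)) p; rewrite (ginvK Go).
  rewrite /w (gcomm_gcomm Go) !(rM _ (gmul o _ (ginv o b))) /=.
  have := fix_ (false, true) _ hVU; rewrite /C /= (gmul1l Go) => ->.
  rewrite (rM _ h) /=.
  have := fix_ (false, false) _ hU; rewrite /C /= !(gmul1l Go) ginv1 // gmul1 // => ->.
  rewrite rM /=.
  have := fix_ (true, false) _ hVU; rewrite /C /= (gmul1 Go) => ->.
  exact: (fix_ (true, true) _ hU).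
apply/funext => y; apply: contrapT => wy.
(* As [w] commutes with [f], it moves each [f^i y], which therefore lies in one of the four
   translates. *)
have /choice[c cP] : forall i : 'I_5, exists c, U (r (ginv o (C c)) (r (gexpn o f i) y)).
  move=> i; apply: suppw => wi; apply: wy.
  have := congr1 (@^~ y) (rM w (gexpn o f i)).
  rewrite (gcommute_sym (gcommuteXn Go i (gcommute_sym wf))) rM /= wi.
  by move=> /(congr1 (r (ginv o (gexpn o f i)))); rewrite !rK.
(* In a common translate, [f^(j-i)] would carry a point of [U] into [U], because it commutes with
   [C (c i)]. *)
have nc (i j : 'I_5) : (i < j)%N -> c i <> c j.
  move=> ij e; have := cP j; rewrite -e -{1}(subnK (ltnW ij)) gexpnD //.
  rewrite rM /= -/((r _ \o r _) _) -rM.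
  rewrite (gcommute_sym (gcommuteXn Go _ (gcommute_sym (Cf (c i))))) rM /=.
  by apply: Uf (cP i); have := ltn_ord j; lia.
have c_inj : injective c.
  move=> i j e; apply: val_inj => /=.
  by case: (ltngtP i j) => // ij; [case: (nc _ _ ij)|case: (nc _ _ ij)].
by have := leq_card c c_inj; rewrite card_ord card_prod card_bool.
Qed.

End Actions.

(** If the rigid stabilizer of [U] acted trivially, the orbit of [p] in [U] would be the closed set
    of [p] alone; nonempty interior would then make [p] isolated. A one-point space has an isolated
    point as well. *)
Lemma rubin_weakly_rubin (T : Type) (o : grp_ops T) :
  rubin_group o -> weakly_rubin_group o.
Proof.
move=> [X [rho [[x _] [[act _ ld] [_ hX iso]]]]]; exists X, rho; split=> //.
- apply: contrapT => one; apply: (iso x).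
  have -> : [set x] = setT :> set X.
    apply/seteqP; split=> // y _; apply: contrapT => xy; apply: one.
    by exists x, y => e; apply: xy.
  exact: openT.
move=> U oU [p Up]; apply: contrapT => nm; apply: (iso p).
have Ap : [set rho g p | g in rigid_stab rho U] `<=` [set p].
  move=> _ [g gU <-] /=; have [-> //|gid] := pselect (rho g = id).
  by case: nm; exists g.
have clp : closure [set rho g p | g in rigid_stab rho U] `<=` [set p].
  have /closure_id -> := @accessible_closed_set1 X (hausdorff_accessible hX) p.
  exact: closureS.
have [q q_int] := ld U p oU Up.
have -> : [set p] = interior (closure [set rho g p | g in rigid_stab rho U]).
  apply/seteqP; split=> [_ ->|y /interior_subset /clp //].
  by have qp : q = p := clp _ (interior_subset q_int); rewrite qp in q_int.
exact: open_interior.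
Qed.

(** * Consequences of the generic conditions *)

Section Generic.
Variables (T : Type) (o : grp_ops T) (Go : is_group o) (tf : torsion_free o).
Local Notation "x * y" := (gmul o x y).
Local Notation "x ^-1" := (ginv o x).
Local Notation "1" := (gone o).
Hypothesis conjugate : forall x y, x <> 1 -> y <> 1 -> exists t, t * x = y * t.
Hypothesis centralizing : forall g h, ~ (exists z, h = gexpz o g z) ->
  exists a b, [/\ gcommute o a g, gcommute o b g,
    gcomm o a (gcomm o b h) <> 1, gcommute o (gcomm o a (gcomm o b h)) g
    & ~ gcommute o (gexpn o a 12) h].

Lemma not_weakly_rubin_quotient (Q : Type) (oQ : grp_ops Q) :
  is_quotient o oQ -> ~ weakly_rubin_group oQ.
Proof.
move=> [GQ [phi [phiM phi_surj]]] [X [rho [hX [x0 [x1 x01]] [rhoH rhoM] lm]]].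
pose r g := rho (phi g).
have rM g h : r (g * h) = r g \o r h by rewrite /r phiM rhoM.
have rC g : continuous (r g) by have [f' []] := rhoH (phi g).
have r1 : r 1 = id.
  have [f' [fK _ _ _]] := rhoH (phi 1).
  apply/funext => x; apply: (can_inj fK).
  by have := congr1 (@^~ x) (rM 1 1); rewrite gmul1 // => /esym.
have rK g x : r g^-1 (r g x) = x.
  by have := congr1 (@^~ x) (rM g^-1 g); rewrite (gmulVl Go) r1.
have lift U : open U -> U !=set0 ->
    exists g, (forall x, ~ U x -> r g x = x) /\ r g <> id.
  move=> oU U0; have [q [qU qid]] := lm U oU U0; have [g gq] := phi_surj q.
  by exists g; rewrite /r gq.
have [f [_ fid]] := lift setT openT (ex_intro _ x0 I).
have f1 : f <> 1 by move=> e; apply: fid; rewrite e.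
(* If a nontrivial [g] acted trivially, so would its conjugate [f]. *)
have faithful g : g <> 1 -> r g <> id.
  move=> g1 gid; apply: fid; have [t tg] := conjugate g1 f1.
  apply/funext => x.
  have := congr1 (fun s => s (r t^-1 x)) (congr1 r tg).
  rewrite !rM gid /= => /esym; have := rK t^-1 x; rewrite ginvK // => ->.
  by [].
(* 12 is a common multiple of 1, 2, 3 and 4, so a point moved by [f^12] is moved by each of the
   first four powers of [f]. *)
have f12 : gexpn o f 12 <> 1 by move=> /(tf (n := 12) isT).
have [x fx] : exists x, r (gexpn o f 12) x <> x.
  by apply: contrapT => nx; apply: (faithful _ f12); apply/funext => x;
    apply: contrapT => xx; apply: nx; exists x.
have fk k : (0 < k <= 4)%N -> r (gexpn o f k) x <> x.
  move=> k4 fkx; apply: fx.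
  have -> : 12 = (k * (12 %/ k))%N by case: k k4 {fkx} => [|[|[|[|[|]]]]].
  rewrite gexpnM //; elim: (12 %/ k)%N => [|n IH]; first by rewrite r1.
  by rewrite gexpnS rM /= IH.
have [U [oU Ux Uf]] := displaced_by_powers rC hX fk.
have [h [hU hid]] := lift U oU (ex_intro _ x Ux).
have [y hy] : exists y, r h y <> y.
  by apply: contrapT => ny; apply: hid; apply/funext => y;
    apply: contrapT => yy; apply: ny; exists y.
have Uy : U y by apply: contrapT => /hU.
(* A power of [f] commutes with [f]; as [f y] lies outside [U], [h] fixes [f y], and would then fix
   [y]. *)
have hf : ~ exists z, h = gexpz o f z.
  move=> [z hz]; apply: hy.
  have fh : gcommute o h f by rewrite hz; apply: gcommuteXz.
  have := congr1 (@^~ y) (congr1 r fh); rewrite !rM /= hU; last first.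
    by have := @Uf 1%N y isT Uy; rewrite gexpn1.
  by move=> /(congr1 (r f^-1)); rewrite !rK.
have [a [b [af bf w1 wf _]]] := centralizing hf.
by apply: (faithful _ w1); apply: (displaced_gcomm_gcomm Go rM r1 Uf hU).
Qed.

(** Powers of [g] commute with [f], so an [h] that does not is outside the group generated by [g],
    and [centralizing] applies to it. *)
Lemma gcommute_alg_disjoint f g : gcommute o f g -> alg_disjoint o g f.
Proof.
move=> fg h fh.
have hg : ~ exists z, h = gexpz o g z.
  move=> [z hz]; apply: fh; apply/gcomm1P => //; apply: gcommute_sym.
  by rewrite hz; apply: gcommuteXz.
by have [a [b [? ? ? ? _]]] := centralizing hg; exists a, b.
Qed.

(** Take [h = g] in the definition: [b] commutes with [g], so the inner commutator is already
    trivial. *)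
Lemma alg_disjoint_gcommute f g : alg_disjoint o g f -> gcommute o f g.
Proof.
move=> fg; apply: contrapT => nfg.
have [|a [b [_ [bg [+ _]]]]] := fg g; first by move=> /(gcomm1P Go).
have -> : gcomm o b g = 1 by apply/gcomm1P.
by case; apply/(gcomm1P Go)/gcommute_sym/gcommute1.
Qed.

(** For [x] outside the group generated by [f], [centralizing] gives an element that commutes with
    [f], hence is algebraically disjoint from it, and whose 12th power does not commute with [x]. *)
Lemma centralizer_S_set f :
  centralizer o (S_set o f) = [set y | exists z, y = gexpz o f z].
Proof.
apply/seteqP; split=> [x xS|_ [z ->] _ [g [gf ->]]].
  apply: contrapT => /centralizing[t [_ [tf' _ _ _ tx]]]; apply: tx.
  apply/gcommute_sym/xS; exists t; split=> //.
  exact/gcommute_alg_disjoint/gcommute_sym.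
apply: gcommuteXz => //; apply/gcommute_sym; apply: gcommuteXn => //.
exact/gcommute_sym/alg_disjoint_gcommute.
Qed.

Lemma subgroup_of_cyclic (H : set T) f : subgroup o H ->
  (forall x, H x -> exists z, x = gexpz o f z) -> cyclic_subgroup o H.
Proof.
move=> [H1 HM HV] Hf.
have HX x z : H x -> H (gexpz o x z).
  move=> Hx; have Hn n : H (gexpn o x n) by elim: n => // n IH; apply: HM.
  by case: z => n; [apply: Hn|apply/HV/Hn].
pose Q n := (0 < n)%N && `[< H (gexpn o f n) >].
have [exQ|nQ] := pselect (exists n, Q n); last first.
  exists 1; apply/seteqP; split=> [x Hx|_ [[n|n] ->]] /=; last 2 first.
  - by rewrite gexpn_one.
  - by rewrite gmul1l // gexpn_one // ginv1.
  exists 0%R; have [[[|n]|n] xz] := Hf x Hx => //; case: nQ; exists n.+1.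
    by apply/andP; split=> //; apply/asboolP; move: Hx; rewrite xz.
  apply/andP; split=> //; apply/asboolP.
  by have := HV x Hx; rewrite xz /gexpz ginvK.
case: (ex_minnP exQ) => n /andP[n0 /asboolP Hn] nmin.
exists (gexpn o f n); apply/seteqP; split=> [x Hx|_ [z ->]]; last exact: HX.
have [z xz] := Hf x Hx; exists (divz z n).
have nE k : gexpz o (gexpn o f n) k = gexpz o f (n%:Z * k)%R by rewrite gexpzM.
have zE := divz_eq z n.
have Hr : H (gexpz o f (modz z n)).
  have -> : modz z n = (z - n%:Z * divz z n)%R by lia.
  rewrite gexpzD // gexpzN // -nE -xz; apply: HM => //; apply: HV; exact: HX.
have m0 : (0 <= modz z n)%R by apply: modz_ge0; lia.
have mn : (modz z n < n)%R by apply: ltz_pmod; lia.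
rewrite nE xz; congr gexpz; rewrite [LHS]zE.
case: (modz z n) m0 mn Hr => // -[|k] _ kn Hr; first lia.
by have := nmin k.+1; rewrite /Q /= asboolT // => /(_ isT); lia.
Qed.

Lemma cyclic_subgroupP (f : T) : subgroup o [set y | exists z, y = gexpz o f z].
Proof.
split; first by exists 0%R.
  by move=> _ _ [z ->] [z' ->]; exists (z + z')%R; rewrite gexpzD.
by move=> _ [z ->]; exists (- z)%R; rewrite gexpzN.
Qed.

(** An intersection of cyclic subgroups is a subgroup of the first one, hence cyclic; a single [f]
    yields each cyclic subgroup. *)
Lemma rubin_poset_cyclic (H : set T) : rubin_poset o H <-> cyclic_subgroup o H.
Proof.
split=> [[n [fs ->]]|[x ->]]; last first.
  exists 0%N, (fun=> x); rewrite -centralizer_S_set.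
  by apply/seteqP; split=> [y yS _|y /(_ ord0)].
have -> : [set x | forall i, centralizer o (S_set o (fs i)) x] =
          [set x | forall i, exists z, x = gexpz o (fs i) z].
  by apply/seteqP; split=> x xS i; have := xS i; rewrite centralizer_S_set.
apply: (@subgroup_of_cyclic _ (fs ord0)); last by move=> x /(_ ord0).
split=> [i|x y Hx Hy i|x Hx i]; have [H1 HM HV] := cyclic_subgroupP (fs i) => //.
  exact: HM (Hx i) (Hy i).
exact: HV (Hx i).
Qed.

(** With [t c t^-1 = c^2], the conjugates [e z = t^-z c t^z] satisfy [e (z + 1)^2 = e z], so the
    groups they generate increase. *)
Lemma rubin_poset_chain : (exists c, c <> 1) -> exists C : int -> set T,
  (forall z, rubin_poset o (C z)) /\
  (forall z, C z `<=` C (z + 1)%R /\ C z <> C (z + 1)%R).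
Proof.
move=> [c c1].
have c2 : gexpn o c 2 <> 1 by move=> /(tf (n := 2) isT).
have [t tc] := conjugate c1 c2.
pose phi z x := gexpz o t (- z)%R * x * gexpz o t z.
have tV z : gexpz o t z * gexpz o t (- z)%R = 1 by rewrite -gexpzD // subrr.
have phiM z : group_hom o o (phi z).
  move=> x y; rewrite /phi !gmulA //; congr (_ * _ * _).
  by rewrite -(gmulA Go _ (gexpz o t z)) tV gmul1.
pose e z := phi z c.
have e2 z : gexpn o (e (z + 1)%R) 2 = e z.
  have -> : e (z + 1)%R = phi z (t^-1 * c * t).
    rewrite /e /phi opprD gexpzD // (gexpzN Go t 1%R) gexpz1 //.
    by rewrite gexpzS // !gmulA.
  rewrite -(homXn Go Go (phiM z)) /e; congr phi.
  rewrite gexpnS gexpn1 // !gmulA // gmulK // -(gmulA Go _ c c).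
  have -> : c * c = gexpn o c 2 by rewrite gexpnS gexpn1.
  by rewrite -gmulA // -tc gmulKl.
have e1 z : e z <> 1.
  rewrite -(hom1 Go Go (phiM z)) => ez; apply: c1.
  by move: ez => /(gmulIr Go)/(gmulIl Go).
exists (fun z => [set y | exists k, y = gexpz o (e z) k]); split=> z.
  by apply/rubin_poset_cyclic; exists (e z).
split=> [_ [k ->]|E].
  by exists (2 * k)%R; rewrite gexpzM // [gexpz _ _ 2%R]e2.
have : [set y | exists k, y = gexpz o (e (z + 1)%R) k] (e (z + 1)%R).
  by exists 1%R; rewrite gexpz1.
(* Equality of two consecutive groups would give [1 = 2 k]. *)
rewrite -E => -[k]; rewrite -(e2 z) -[gexpn _ _ 2]/(gexpz o _ 2%R) -gexpzM //.
rewrite -{1}(gexpz1 Go (e (z + 1)%R)) => /(gexpz_inj Go tf (@e1 _)).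
by lia.
Qed.

(** The groups generated by [c^p] for distinct primes [p]: as [c] has infinite order, inclusion
    amounts to divisibility of the exponents. *)
Lemma rubin_poset_antichain : (exists c, c <> 1) -> exists A : nat -> set T,
  (forall n, rubin_poset o (A n)) /\
  (forall m n, m <> n -> ~ (A m `<=` A n)).
Proof.
move=> [c c1].
pose next m := sval (sig_of_sig2 (prime_above m)).
pose p n := iter n next 2.
have p_prime n : prime (p n).
  by elim: n => //= n _; rewrite /next; case: (prime_above (p n)).
have p_mono : {homo p : m n / (m < n)%N}.
  apply: homo_ltn; first exact: ltn_trans.
  by move=> n; rewrite /= /next; case: (prime_above (p n)).
exists (fun n => [set y | exists k, y = gexpz o (gexpn o c (p n)) k]); split=> [n|m n mn].
  by apply/rubin_poset_cyclic; exists (gexpn o c (p n)).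
have nE q k : gexpz o (gexpn o c q) k = gexpz o c (q%:Z * k)%R by rewrite gexpzM.
move=> /(_ (gexpn o c (p m))) /= [|k].
  by exists 1%R; rewrite gexpz1.
rewrite nE -[gexpn _ _ (p m)]/(gexpz o c (p m)) => /(gexpz_inj Go tf c1) e.
have : (Posz (p n) %| Posz (p m))%Z by apply/dvdzP; exists k; rewrite e mulrC.
rewrite dvdzE !absz_nat dvdn_prime2 // => /eqP pe.
by case: (ltngtP m n) mn => // /p_mono; rewrite pe ltnn.
Qed.

End Generic.

(** * The countable family of dense open sets *)

(** Both families are coded by one number, with a boolean tag; a number that codes nothing gives the
    whole space. *)
Definition generic_condition (k : nat) : set (grp_ops nat) :=
  match unpickle k : option (bool * nat * nat)%type with
  | Some (true, x, y) => [set o | Gtf o /\ exists t, conj_witness x y t o]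
  | Some (false, g, h) => [set o | Gtf o /\ exists c, cent_witness g h c o]
  | None => Gtf
  end.

Theorem theorem1p2 :
  comeager_in_Gtf (fun o : grp_ops nat =>
    (* (1) no Rubin or weakly Rubin quotient *)
    (forall (Q : Type) (oQ : grp_ops Q), is_quotient o oQ ->
        ~ rubin_group oQ /\ ~ weakly_rubin_group oQ) /\
    (* (2) P(G) = cyclic subgroups; bi-infinite chains; infinite antichains *)
    ((forall H : set nat, rubin_poset o H <-> cyclic_subgroup o H) /\
     (exists C : int -> set nat,
        (forall z, rubin_poset o (C z)) /\
        (forall z, C z `<=` C (z + 1)%R /\ C z <> C (z + 1)%R)) /\
     (exists A : nat -> set nat,
        (forall n, rubin_poset o (A n)) /\
        (forall m n, m <> n -> ~ (A m `<=` A n)))) /\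
    (* (3) nontrivial elements commute iff algebraically disjoint *)
    (forall f g : nat, f <> gone o -> g <> gone o ->
        (gcommute o f g <-> alg_disjoint o g f))).
Proof.
exists generic_condition; split.
  move=> k; rewrite /generic_condition; case: unpickle => [[[[] x] y]|].
  - split; last exact: dense_conj_witness.
    exact/open_in_Gtf_exists/locally_constant_conj_witness.
  - split; last exact: dense_cent_witness.
    exact/open_in_Gtf_exists/locally_constant_cent_witness.
  - by split=> [|o n ?]; [split=> // o _; exists 0%N|exists o].
move=> o Ho.
have conj_o x y : Gtf o /\ exists t, conj_witness x y t o.
  by have := Ho (pickle (true, x, y)); rewrite /generic_condition pickleK.
have cent_o g h : Gtf o /\ exists c, cent_witness g h c o.
  by have := Ho (pickle (false, g, h)); rewrite /generic_condition pickleK.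
have [[Go tf] _] := conj_o 0%N 0%N.
have conjugate x y : x <> gone o -> y <> gone o ->
    exists t, gmul o t x = gmul o y t.
  by move=> x1 y1; have [_ [t [|[|]]]] := conj_o x y => //; exists t.
have centralizing g h : ~ (exists z, h = gexpz o g z) ->
    exists a b, [/\ gcommute o a g, gcommute o b g,
      gcomm o a (gcomm o b h) <> gone o,
      gcommute o (gcomm o a (gcomm o b h)) g
      & ~ gcommute o (gexpn o a 12) h].
  move=> hg; have [_ [[[z a] b] [hz|[[ag bg] [[w1 wg] ah]]]]] := cent_o g h.
    by case: hg; exists z.
  by exists a, b.
have nontrivial : exists c, c <> gone o.
  by exists (gone o).+1 => /esym/n_Sn.
split; [|split; [split; [|split]|]].
- move=> Q oQ oQo; have nQ := not_weakly_rubin_quotient Go tf conjugate centralizing oQo.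
  by split=> // /rubin_weakly_rubin.
- exact: rubin_poset_cyclic.
- exact: rubin_poset_chain.
- exact: rubin_poset_antichain.
- move=> f g _ _; split; first exact: gcommute_alg_disjoint.
  exact: alg_disjoint_gcommute.
Qed.
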